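(* Let $\mathbb{K}$ be a field of characteristic different from $2$. Every $3$-dimensional solvable skew-symmetric $\mathbb{K}$-algebra is a Lie algebra or is isomorphic to a non-Lie algebra with basis $\{e_1,e_2,e_3\}$ and multiplication given by $$\mu(e_1,e_2)=\beta_1e_2+\gamma_1e_3,\quad \mu(e_1,e_3)=\beta_2e_2+\gamma_2e_3,\quad \mu(e_2,e_3)=e_3,$$ for some $\beta_1,\beta_2,\gamma_1,\gamma_2\in\mathbb{K}$ with $\beta_1\neq 0$ or $\beta_2\neq 0$.
   Context: A skew-symmetric $\mathbb{K}$-algebra $A=(V,\mu)$ is a vector space $V$ with a bilinear map $\mu:V\times V\to V$ satisfying $\mu(X,Y)=-\mu(Y,X)$; no further identity is assumed. Set $\mathcal{D}^0(\mu)=A$, $\mathcal{D}^1(\mu)=\mu(A,A)$ and $\mathcal{D}^k(\mu)=\mu(\mathcal{D}^{k-1}(\mu),\mathcal{D}^{k-1}(\mu))$ for $k\ge 2$ (linear spans of products). $A$ is solvable if $\mathcal{D}^k(\mu)=0$ for some $k$. Algebras $(V,\mu)$, $(V',\mu')$ are isomorphic if there is a linear bijection $f:V\to V'$ with $f(\mu(X,Y))=\mu'(f(X),f(Y))$ for all $X,Y$. *)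

(* Defs.v *)
From HB Require Import structures.
From mathcomp Require Import all_boot all_algebra.

Set Implicit Arguments.
Unset Strict Implicit.
Unset Printing Implicit Defensive.

Import GRing.Theory.
Local Open Scope ring_scope.

(* Finite-dimensional skew-symmetric algebras; no Jacobi identity is assumed. *)
Record skewAlgebra (K : fieldType) := SkewAlgebra {
  skew_space :> vectType K;
  skew_mul : {bilinear skew_space -> skew_space -> skew_space};
  skew_mulN : forall x y, skew_mul x y = - skew_mul y x
}.

Section SkewAlgebraTheory.

Variables (K : fieldType) (A : skewAlgebra K).
Implicit Types (U V W : {vspace A}) (x y z : A).

Local Notation mu := (skew_mul A).

(* As for prodv in falgebra, products of basis vectors suffice to span; *)
(* mulvP shows that this is the span of all the products mu u v.        *)
Definition mulv U V : {vspace A} :=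
  <<[seq mu u v | u <- vbasis U, v <- vbasis V]>>%VS.

Lemma memv_mulv U V u v : u \in U -> v \in V -> mu u v \in mulv U V.
Proof.
move=> /coord_vbasis-> /coord_vbasis->.
rewrite linear_sumlz; apply: memv_suml => i _.
rewrite linearZl_LR linear_sumr /=; apply/memvZ/memv_suml => j _.
rewrite linearZr_LR; apply/memvZ/memv_span/allpairsP.
by exists ((vbasis U)`_i, (vbasis V)`_j); rewrite !memt_nth.
Qed.

Lemma mulvP U V W :
  (forall u v, u \in U -> v \in V -> mu u v \in W) <-> (mulv U V <= W)%VS.
Proof.
split=> [sUVW | sUVW u v Uu Vv]; last by rewrite (subvP sUVW) ?memv_mulv.
apply/span_subvP=> _ /allpairsP[[u v] /= [Uu Vv ->]].
by rewrite sUVW ?vbasis_mem.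
Qed.

Fixpoint derived_series k : {vspace A} :=
  if k is k'.+1 then mulv (derived_series k') (derived_series k')
  else fullv.

Definition solvable_alg : Prop := exists k, derived_series k = 0%VS.

(* The alternating law follows from skew_mulN only in characteristic not 2, *)
(* so this is the usual notion of Lie algebra only under that assumption.   *)
Definition is_lie : Prop :=
  forall x y z, mu x (mu y z) + mu y (mu z x) + mu z (mu x y) = 0.

End SkewAlgebraTheory.

Arguments solvable_alg {K} A.
Arguments is_lie {K} A.

Definition skew_isomorphic (K : fieldType) (A B : skewAlgebra K) : Prop :=
  exists f : {linear A -> B},
    bijective f /\ forall x y, f (skew_mul A x y) = skew_mul B (f x) (f y).

(* Main.v *)
Require Import Defs.
From HB Require Import structures.
From mathcomp Require Import all_boot all_algebra.

Set Implicit Arguments.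
Unset Strict Implicit.
Unset Printing Implicit Defensive.

Import GRing.Theory.
Local Open Scope ring_scope.

(* Solvability makes the derived algebra proper, so it lies in the span U of  *)
(* the last two vectors of some basis e1, u, v. If w := mu u v is 0 then U is *)
(* an abelian ideal and A is Lie. Otherwise w spans mu(U, U), and some e2 in  *)
(* U satisfies mu e2 w = w; for the basis e1, e2, w the Jacobiator of the     *)
(* three basis vectors is b2 e2 - b1 w, and it vanishes iff A is Lie.         *)

(** In characteristic not 2 the Jacobiator is trilinear and alternating, so in dimension 3 the
    Jacobi identity is one equation on one basis ([is_lie_basis]). [solvable_derived_proper] and
    [basis_avoiding_proper] provide the plane [U]. If [w = a u + b v], then [mu u w = b w] and
    [mu v w = - a w], so [U] acts on the line of [w] by a linear form, nonzero because [w] is;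
    rescaling gives [e2] ([plane_left_unit]). *)

Section Jacobiator.

Variables (K : fieldType) (A : skewAlgebra K).
Implicit Types (x y z : A) (X : seq A).

Local Notation mu := (skew_mul A).

Definition jacobiator x y z : A :=
  mu x (mu y z) + mu y (mu z x) + mu z (mu x y).

Lemma jacobiator_rot x y z : jacobiator y z x = jacobiator x y z.
Proof. by rewrite /jacobiator -[RHS]addrA [RHS]addrC. Qed.

Lemma jacobiator_swap x y z : jacobiator y x z = - jacobiator x y z.
Proof.
rewrite /jacobiator (skew_mulN x z) (skew_mulN z y) (skew_mulN y x).
by rewrite !linearNr !opprD [X in X + _ = _]addrC.
Qed.

Lemma jacobiator_is_linear x y : linear (jacobiator x y).
Proof.
move=> a z z'; rewrite /jacobiator !(linearPr, linearPl) !scalerDr.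
by rewrite [RHS]addrACA; congr (_ + _); rewrite addrACA.
Qed.

HB.instance Definition _ x y :=
  GRing.isLinear.Build K A A _ (jacobiator x y) (jacobiator_is_linear x y).

Lemma jacobiator_span X x y :
    {in X, forall z, jacobiator x y z = 0} ->
  {in <<X>>%VS, forall z, jacobiator x y z = 0}.
Proof.
move=> X0 z /(@coord_span _ _ _ (in_tuple X))->.
by rewrite linear_sum big1 // => i _; rewrite linearZ /= X0 ?scaler0 ?mem_nth.
Qed.

Hypothesis charK : 2%N \notin [pchar K].

Lemma skew_mul_alt x : mu x x = 0.
Proof.
have two_neq0 : 2%:R != 0 :> K by move: charK; rewrite inE.
have /eqP : 2%:R *: mu x x = 0 by rewrite scaler_nat mulr2n {1}skew_mulN addNr.
by rewrite scaler_eq0 (negPf two_neq0) => /eqP.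
Qed.

Lemma jacobiator_alt x z : jacobiator x x z = 0.
Proof.
by rewrite /jacobiator skew_mul_alt linear0r addr0 (skew_mulN z) linearNr subrr.
Qed.

Lemma is_lie_basis e1 e2 e3 :
    basis_of fullv [:: e1; e2; e3] -> jacobiator e1 e2 e3 = 0 -> is_lie A.
Proof.
move=> /span_basis spanX J0 x y z; rewrite -/(jacobiator x y z).
have memX t : t \in <<[:: e1; e2; e3]>>%VS by rewrite spanX memvf.
apply: jacobiator_span (memX z) => z' X'z.
(* Rotation brings each remaining argument to the last slot, where linearity is available. *)
rewrite -jacobiator_rot; apply: jacobiator_span (memX x) => x' X'x.
rewrite -jacobiator_rot; apply: jacobiator_span (memX y) => y' X'y.
have alt2 s t : jacobiator s t t = 0 by rewrite -jacobiator_rot jacobiator_alt.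
have alt3 s t : jacobiator s t s = 0 by rewrite jacobiator_rot jacobiator_alt.
have J1 : jacobiator e2 e3 e1 = 0 by rewrite jacobiator_rot.
have J2 : jacobiator e3 e1 e2 = 0 by rewrite jacobiator_rot.
have N0 : jacobiator e2 e1 e3 = 0 by rewrite jacobiator_swap J0 oppr0.
have N1 : jacobiator e3 e2 e1 = 0 by rewrite jacobiator_swap J1 oppr0.
have N2 : jacobiator e1 e3 e2 = 0 by rewrite jacobiator_swap J2 oppr0.
move: X'x X'y X'z; rewrite !inE.
(* Of the 27 triples of basis vectors, those with a repetition vanish by alternation; the other six
   are permutations of [e1, e2, e3]. *)
by do 3![case/or3P=> /eqP->]; rewrite ?jacobiator_alt ?alt2 ?alt3.
Qed.

End Jacobiator.

(** A complement of [W] is nonzero, so its basis has a first vector [e]; the rest of that basis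
    together with a basis of [W] forms [X]. *)
Lemma basis_avoiding_proper (K : fieldType) (vT : vectType K) (W : {vspace vT}) :
    W != fullv ->
  exists e (X : seq vT), basis_of fullv (e :: X) /\ (W <= <<X>>)%VS.
Proof.
move=> W_proper; have := vbasisP W^C.
case: (vbasis W^C : seq vT) => [|e X] basisC.
  case/eqP: W_proper; rewrite -(addv_complf W).
  by rewrite -(span_basis basisC) span_nil addv0.
exists e, (X ++ vbasis W); split; last first.
  by rewrite span_cat (span_basis (vbasisP W)) addvSr.
have directC : directv (W^C + W) by apply/directv_addP; rewrite capvC capv_compl.
by have := cat_basis directC basisC (vbasisP W); rewrite addvC addv_complf.
Qed.

Lemma memv_span2P (K : fieldType) (vT : vectType K) (u v x : vT) :
  reflect (exists a b, x = a *: u + b *: v) (x \in <<[:: u; v]>>%VS).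
Proof.
rewrite span_cons span_seq1.
apply: (iffP memv_addP) => [[_ /vlineP[a ->] [_ /vlineP[b ->] ->]]|[a [b ->]]].
  by exists a, b.
by exists (a *: u); [|exists (b *: v)]; rewrite ?memvZ ?memv_line.
Qed.

Section SolvableSkewAlgebra.

Variables (K : fieldType) (A : skewAlgebra K).
Implicit Types (u v : A).

Local Notation mu := (skew_mul A).

(** Were the first derived space everything, the series would stay constant and never reach 0. *)
Lemma solvable_derived_proper :
    solvable_alg A -> \dim (fullv : {vspace A}) != 0%N ->
  mulv fullv fullv != (fullv : {vspace A}).
Proof.
case=> k Dk0; apply: contraNneq => D1.
suff: derived_series A k = fullv by rewrite Dk0 => <-; rewrite dimv0.
by elim: k {Dk0} => //= k ->.
Qed.

Hypothesis charK : 2%N \notin [pchar K].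

(** The form sending [u] to [b] and [v] to [- a] takes the value 1 at [b^-1 u] if [b != 0], and at
    [- a^-1 v] otherwise. It vanishes at [w], so [e2] and [w] still span the plane. *)
Lemma plane_left_unit u v :
    mu u v \in <<[:: u; v]>>%VS -> mu u v != 0 ->
  exists2 e2, mu e2 (mu u v) = mu u v
            & (<<[:: u; v]>> <= <<[:: e2; mu u v]>>)%VS.
Proof.
case/memv_span2P=> a [b]; set w := mu u v => defw w_neq0.
have [b0|b_neq0] := eqVneq b 0.
  have a_neq0 : a != 0.
    by apply: contraNneq w_neq0 => a0; rewrite defw a0 b0 !scale0r addr0.
  have {}defw : w = a *: u by rewrite defw b0 scale0r addr0.
  exists (- (a^-1 *: v)).
    rewrite {1}defw linearNl linearZr_LR linearZl_LR /= (skew_mulN v u) scalerN.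
    by rewrite scalerN opprK scalerA mulfV // scale1r.
  apply/span_subvP=> x; rewrite !inE => /orP[]/eqP->; apply/memv_span2P.
    by exists 0, a^-1; rewrite scale0r add0r defw scalerA mulVf ?scale1r.
  exists (- a), 0; rewrite scale0r addr0 scalerN scaleNr opprK scalerA.
  by rewrite mulfV ?scale1r.
exists (b^-1 *: u).
  rewrite {1}defw linearZl_LR /= linearDr !linearZr_LR (skew_mul_alt charK u).
  by rewrite scaler0 add0r scalerA mulVf // scale1r.
apply/span_subvP=> x; rewrite !inE => /orP[]/eqP->; apply/memv_span2P.
  by exists b, 0; rewrite scale0r addr0 scalerA mulfV ?scale1r.
exists (- a), b^-1; rewrite defw scalerDr !scalerA mulVf // scale1r addrA.
by rewrite mulrC mulrN scaleNr addNr add0r.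
Qed.

End SolvableSkewAlgebra.

Theorem proposition11 (K : fieldType) (charK : 2%N \notin [pchar K])
    (A : skewAlgebra K) (dimA : \dim (fullv : {vspace A}) = 3%N)
    (solA : solvable_alg A) :
  is_lie A \/
  exists (B : skewAlgebra K) (e1 e2 e3 : B) (b1 b2 c1 c2 : K),
    [/\ basis_of fullv [:: e1; e2; e3],
        [/\ skew_mul B e1 e2 = b1 *: e2 + c1 *: e3,
            skew_mul B e1 e3 = b2 *: e2 + c2 *: e3
          & skew_mul B e2 e3 = e3],
        b1 != 0 \/ b2 != 0,
        ~ is_lie B
      & skew_isomorphic A B].
Proof.
have D1_proper := solvable_derived_proper solA.
have [|e1 [X [basisX D1X]]] := basis_avoiding_proper (D1_proper _).
  by rewrite dimA.
have mulX x y : skew_mul A x y \in <<X>>%VS.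
  by apply: (subvP D1X); rewrite memv_mulv ?memvf.
(* Counting dimensions forces [X] to consist of two vectors. *)
have := basis_free basisX; rewrite /free (span_basis basisX) dimA.
case: X basisX mulX {D1X} => [|u [|v []]] //= basisX mulX _.
have [uv0|uv_neq0] := eqVneq (skew_mul A u v) 0.
  left; apply: (is_lie_basis charK basisX).
  (* The inner products lie in the span of [u] and [v], on which [mu] vanishes. *)
  rewrite /jacobiator uv0 linear0r add0r.
  have /memv_span2P[a [b ->]] := mulX v e1.
  have /memv_span2P[c [d ->]] := mulX e1 u.
  rewrite !linearDr !linearZr_LR /= !(skew_mul_alt charK) (skew_mulN v u) uv0.
  by rewrite oppr0 !scaler0 !addr0.
have [e2 e2w sub_uv] := plane_left_unit charK (mulX u v) uv_neq0.
move: (skew_mul A u v) e2w sub_uv {uv_neq0} => w e2w sub_uv.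
have basis_e : basis_of fullv [:: e1; e2; w].
  (* Three vectors spanning a space of dimension 3 form a basis. *)
  rewrite basisEdim dimA andbT -(span_basis basisX) [X in (X <= _)%VS]span_cons.
  by rewrite [X in (_ <= X)%VS]span_cons addvS.
have /memv_span2P[b1 [c1 e1e2]] := subvP sub_uv _ (mulX e1 e2).
have /memv_span2P[b2 [c2 e1w]] := subvP sub_uv _ (mulX e1 w).
(* The two [c2 w] terms cancel, and [c1] disappears because [mu w w = 0]. *)
have jac : jacobiator e1 e2 w = b2 *: e2 - b1 *: w.
  rewrite /jacobiator e2w (skew_mulN w e1) e1w e1e2 linearNr.
  rewrite !linearDr !linearZr_LR /=.
  rewrite !(skew_mul_alt charK) (skew_mulN w e2) e2w !scaler0 add0r addr0.
  by rewrite addrK scalerN.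
have [b_eq0|b_neq0] := boolP ((b1 == 0) && (b2 == 0)).
  left; apply: (is_lie_basis charK basis_e); rewrite jac.
  by case/andP: b_eq0 => /eqP-> /eqP->; rewrite !scale0r subrr.
(* [A] itself has the required form in the new basis, so the isomorphism is the identity. *)
right; exists A, e1, e2, w, b1, b2, c1, c2; split=> //.
- by move: b_neq0; rewrite negb_and => /orP.
(* The Jacobi identity would make [b2 e2 - b1 w = 0] a nontrivial relation between independent
   vectors. *)
- move/(_ e1 e2 w); rewrite -/(jacobiator e1 e2 w) jac => J0.
  have := basis_free basis_e; rewrite free_cons => /andP[_].
  move/freeP=> /(_ (fun i => [:: b2; - b1]`_i)).
  rewrite !big_ord_recl big_ord0 /= addr0 scaleNr J0 => /(_ erefl) b0.
  have /= b2_0 := b0 ord0; have /= b1_0 := b0 (lift ord0 ord0).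
  by move: b_neq0; rewrite b2_0 -oppr_eq0 b1_0 eqxx.
- by exists idfun; split=> //; exists idfun.
Qed.
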